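(* Let $P,P',P'',Q,S_1,S_2$ be programs and $B$ a Boolean expression such that $P'\equiv_B(P,B)$ and $P''\equiv_B(P,\neg B)$. If the operational triples $\{|P'|\}\ S_1\ \{|Q|\}$ and $\{|P''|\}\ S_2\ \{|Q|\}$ hold, then $\{|P|\}\ \mathbf{if}\ B\ \mathbf{then}\ S_1\ \mathbf{else}\ S_2\ \mathbf{fi}\ \{|Q|\}$ holds.
   Context: Programs are statements of a sequential imperative language with a standard small-step operational semantics over program states. $\mathrm{behs}(P)$ is the set of pairs (initial state, final state) of finite terminating executions of $P$; $(s,u)\in\mathrm{behs}(P;Q)$ iff there is $t$ with $(s,t)\in\mathrm{behs}(P)$ and $(t,u)\in\mathrm{behs}(Q)$. For a state $s$ and Boolean expression $B$, $s(B)\in\{\mathit{tt},\mathit{ff}\}$ is the (side-effect-free) value of $B$ in $s$. The statement $\mathbf{if}\ B\ \mathbf{then}\ S_1\ \mathbf{else}\ S_2\ \mathbf{fi}$ started in state $s$ executes $S_1$ from $s$ if $s(B)=\mathit{tt}$ and $S_2$ from $s$ otherwise. The post-state set is $\mathrm{pst}(P)=\{t:\exists s,\ (s,t)\in\mathrm{behs}(P)\}$. The operational triple $\{|P|\}\ S\ \{|Q|\}$ means $\mathrm{pst}(P;S)\subseteq\mathrm{pst}(Q)$. For programs $P',P$ and Boolean expression $B$, $P'\equiv_B(P,B)$ means $\mathrm{pst}(P')=\mathrm{pst}(P)\cap\{s : s(B)=\mathit{tt}\}$. *)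

(* Defs.v *)
From Stdlib Require Import ZArith Relations.
Open Scope Z_scope.

Definition var := nat.
Definition state := var -> Z.

Inductive aexp : Type :=
  | ANum (n : Z)
  | AVar (x : var)
  | APlus (a1 a2 : aexp)
  | AMinus (a1 a2 : aexp)
  | AMult (a1 a2 : aexp).

Inductive bexp : Type :=
  | BTrue
  | BFalse
  | BEq (a1 a2 : aexp)
  | BLe (a1 a2 : aexp)
  | BNot (b : bexp)
  | BAnd (b1 b2 : bexp).

Fixpoint aeval (s : state) (a : aexp) : Z :=
  match a with
  | ANum n => n
  | AVar x => s x
  | APlus a1 a2 => aeval s a1 + aeval s a2
  | AMinus a1 a2 => aeval s a1 - aeval s a2
  | AMult a1 a2 => aeval s a1 * aeval s a2
  end.

Fixpoint beval (s : state) (b : bexp) : bool :=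
  match b with
  | BTrue => true
  | BFalse => false
  | BEq a1 a2 => Z.eqb (aeval s a1) (aeval s a2)
  | BLe a1 a2 => Z.leb (aeval s a1) (aeval s a2)
  | BNot b => negb (beval s b)
  | BAnd b1 b2 => andb (beval s b1) (beval s b2)
  end.

Inductive stmt : Type :=
  | Skip
  | Assign (x : var) (a : aexp)
  | Seq (S1 S2 : stmt)
  | If (b : bexp) (S1 S2 : stmt)
  | While (b : bexp) (S : stmt).

Definition update (s : state) (x : var) (v : Z) : state :=
  fun y => if Nat.eqb y x then v else s y.

(* small-step semantics on configurations (statement, state);
   a configuration (Skip, t) is terminal *)
Inductive step : stmt * state -> stmt * state -> Prop :=
  | st_assign : forall x a s,
      step (Assign x a, s) (Skip, update s x (aeval s a))
  | st_seq_skip : forall S2 s,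
      step (Seq Skip S2, s) (S2, s)
  | st_seq : forall S1 S1' S2 s s',
      step (S1, s) (S1', s') -> step (Seq S1 S2, s) (Seq S1' S2, s')
  | st_if_true : forall b S1 S2 s,
      beval s b = true -> step (If b S1 S2, s) (S1, s)
  | st_if_false : forall b S1 S2 s,
      beval s b = false -> step (If b S1 S2, s) (S2, s)
  | st_while : forall b S s,
      step (While b S, s) (If b (Seq S (While b S)) Skip, s).

Definition steps := clos_refl_trans (stmt * state) step.

Definition behs (P : stmt) (s t : state) : Prop := steps (P, s) (Skip, t).

Definition pst (P : stmt) (t : state) : Prop := exists s, behs P s t.

Definition op_triple (P S Q : stmt) : Prop :=
  forall t, pst (Seq P S) t -> pst Q t.

Definition equivB (P' P : stmt) (B : bexp) : Prop :=
  forall t, pst P' t <-> (pst P t /\ beval t B = true).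

(* Main.v *)
(* A terminating run of [P; if B then S1 else S2 fi] splits at an intermediate
   state [t] in pst(P), after which the branch selected by [t(B)] runs.  By the
   two equivalences [t] lies in pst(P') or in pst(P''), and prefixing the run of
   the branch with a run of P' (resp. P'') ending in [t] gives a run of [P'; S1]
   (resp. [P''; S2]), whose final state is in pst(Q) by hypothesis. *)
Require Import Defs.
From Stdlib Require Import Relations.

Lemma steps_seq_l (S : stmt) (c c' : stmt * state) :
  steps c c' -> steps (Seq (fst c) S, snd c) (Seq (fst c') S, snd c').
Proof.
  induction 1 as [[P s] [P' s'] Hstep | | c1 c2 c3 _ IH12 _ IH23].
  - apply rt_step, st_seq, Hstep.
  - apply rt_refl.
  - exact (rt_trans _ _ _ _ _ IH12 IH23).
Qed.

Lemma behs_seq_intro (P S : stmt) (s t u : state) :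
  behs P s t -> behs S t u -> behs (Seq P S) s u.
Proof.
  intros HP HS.
  apply rt_trans with (Seq Skip S, t).
  - exact (steps_seq_l S (P, s) (Skip, t) HP).
  - apply rt_trans with (S, t); [apply rt_step, st_seq_skip | exact HS].
Qed.

Lemma behs_seq_elim (P S : stmt) (s u : state) :
  behs (Seq P S) s u -> exists t, behs P s t /\ behs S t u.
Proof.
  unfold behs; intro H; apply clos_rt_rt1n in H.
  remember (Seq P S, s) as c eqn:Ec; remember (Skip, u) as c' eqn:Ec'.
  revert P s Ec.
  induction H as [c | c c1 c' Hstep Hrest IH]; intros P s Ec; subst.
  - discriminate.
  - inversion Hstep as [| ? ? | ? P1 ? ? s1 HP | | |]; subst.
    + exists s; split; [apply rt_refl | apply clos_rt1n_rt, Hrest].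
    + destruct (IH eq_refl P1 s1 eq_refl) as [t [HP1 HS]].
      exists t; split; [apply rt_trans with (P1, s1); [apply rt_step, HP |] |]; assumption.
Qed.

Lemma behs_if_elim (B : bexp) (S1 S2 : stmt) (t u : state) :
  behs (If B S1 S2) t u -> behs (if beval t B then S1 else S2) t u.
Proof.
  unfold behs; intro H; apply clos_rt_rt1n in H.
  inversion H as [| c ? Hstep Hrest]; subst.
  apply clos_rt1n_rt in Hrest.
  inversion Hstep as [| | | ? ? ? ? Hb | ? ? ? ? Hb |]; subst; rewrite Hb; exact Hrest.
Qed.

Lemma pst_seq (P S : stmt) (u : state) :
  pst (Seq P S) u <-> exists t, pst P t /\ behs S t u.
Proof.
  split.
  - intros [s Hrun]; destruct (behs_seq_elim P S s u Hrun) as [t [HP HS]].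
    exists t; split; [exists s |]; assumption.
  - intros [t [[s HP] HS]]; exists s; exact (behs_seq_intro P S s t u HP HS).
Qed.

Lemma op_tripleP (P S Q : stmt) :
  op_triple P S Q <-> (forall t u, pst P t -> behs S t u -> pst Q u).
Proof.
  unfold op_triple; split.
  - intros H t u Ht Hrun; apply H, pst_seq; exists t; split; assumption.
  - intros H u Hu; apply pst_seq in Hu as [t [Ht Hrun]]; exact (H t u Ht Hrun).
Qed.

Theorem theorem3 (P P' P'' Q S1 S2 : stmt) (B : bexp) :
  equivB P' P B ->
  equivB P'' P (BNot B) ->
  op_triple P' S1 Q ->
  op_triple P'' S2 Q ->
  op_triple P (If B S1 S2) Q.
Proof.
  intros E1 E2 T1 T2.
  apply op_tripleP; intros t u Ht Hrun.
  apply behs_if_elim in Hrun.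
  destruct (beval t B) eqn:Hb.
  - apply (proj1 (op_tripleP _ _ _) T1 t u); [apply E1; split |]; assumption.
  - apply (proj1 (op_tripleP _ _ _) T2 t u); [apply E2; split |]; trivial.
    simpl; rewrite Hb; reflexivity.
Qed.
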